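(* Let $g\ge 3$, $k\ge 0$, let $m,n\ge1$ be odd integers, and let $\alpha,\beta$ be non-negative integers with $\alpha\ne 1$, $\beta\ne 1$ and $\alpha+\beta=3\cdot 2^kmn$. Then an $RSM_\Gamma(\Gamma\setminus 2\Gamma,g;[\,^{\alpha}m,\ ^{\beta}2^kn])$ exists.
   Context: Let $G=\mathbb{Z}_m\times\mathbb{Z}_{2^{k+1}n}$ and let $\Gamma$ be the generalized dihedral group on $G$: underlying set $G\times\mathbb{Z}_2$ with operation $(x,\tau)+(x',\tau')=(x+(-1)^\tau x',\tau+\tau')$; elements written $(a,b,\tau)$. Let $2\Gamma=\{(a,b,0): a\in\mathbb{Z}_m,\ b\in\mathbb{Z}_{2^{k+1}n}\text{ even}\}$, a subset of order $2^kmn$. $[\,^{a}x,\,^{b}y]$ denotes the multiset with $a$ copies of $x$ and $b$ copies of $y$. For $S\subseteq\Gamma$ and a list $L$ of positive integers of length $|S|$, an $RSM_\Gamma(S,g;L)$ is an $|S|\times g$ matrix with entries in $\Gamma$ such that each column is a permutation (arrangement) of $S$ and the multiset of orders (in $\Gamma$) of the left-to-right row sums equals $L$. *)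

(* Defs.v *)
From mathcomp Require Import all_boot.
Set Implicit Arguments. Unset Strict Implicit. Unset Printing Implicit Defensive.

(* Elements of the generalized dihedral group Gamma on G = Z_m x Z_N are
   represented as ((a, b), tau) with a < m, b < N, tau : bool (tau = true is 1). *)
Definition elt := (nat * nat * bool)%type.

Definition gzero : elt := (0, 0, false).

Definition gadd (m N : nat) (x y : elt) : elt :=
  let: (a, b, t) := x in
  let: (a', b', t') := y in
  if t then ((a + (m - a')) %% m, (b + (N - b')) %% N, ~~ t')
  else ((a + a') %% m, (b + b') %% N, t').

Definition gmul (m N : nat) (d : nat) (x : elt) : elt := iter d (gadd m N x) gzero.

(* order of x in Gamma: least d >= 1 with d x = 0 (it is at most |Gamma| = 2mN) *)
Definition gorder (m N : nat) (x : elt) : nat :=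
  (find (fun d => gmul m N d x == gzero) (iota 1 (2 * m * N))).+1.

Definition Gamma (m N : nat) : seq elt :=
  flatten [seq [seq (a, b, t) | b <- iota 0 N, t <- [:: false; true]] | a <- iota 0 m].

(* Gamma \ 2Gamma, where 2Gamma = {(a,b,0) : b even} *)
Definition Gamma_minus_2Gamma (m N : nat) : seq elt :=
  [seq x <- Gamma m N | x.2 || odd x.1.2].

Definition rowsum (m N : nat) (M : seq (seq elt)) (i : nat) : elt :=
  foldl (fun acc c => gadd m N acc (nth gzero c i)) gzero M.

(* RSM_Gamma(S, g; L): an |S| x g matrix (list of g columns) with each column
   an arrangement of S and the multiset of orders of row sums equal to L. *)
Definition RSM (m N : nat) (S : seq elt) (g : nat) (L : seq nat) : Prop :=
  exists M : seq (seq elt),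
    [/\ size M = g,
        (forall c, c \in M -> perm_eq c S) &
        perm_eq [seq gorder m N (rowsum m N M i) | i <- iota 0 (size S)] L].

(* Main.v *)
Require Import Defs.
From mathcomp Require Import all_boot ssralg ssrint intdiv.
From mathcomp Require Import zify ring.
Set Implicit Arguments. Unset Strict Implicit. Unset Printing Implicit Defensive.
Import GRing.Theory.

(** Write v = 2^k n, N = 2v, and fix o in Z_m x Z_N with odd second coordinate.
    Let w = (a, 2i) range over Z_m x 2Z_N, indexed by the cells (a, i) of an
    m x v grid.  The elements x = +-(o + 2w) (tau = 0), y = -w and z = o + w
    (tau = 1) then run through Gamma \ 2Gamma, where the sign is + everywhere if
    v is odd, and + exactly on the half i < v/2 if v is even.  As z = x + y or
    z = y - x, the letters x, y, z of w, placed in three cyclic orders, give three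
    rows with zero sum, one with z in each column: this is a zero-sum matrix with
    three columns.

    Permuting the z-entries of one column by p makes the row sums +-(w - p(w)),
    of order m or v when p moves w horizontally or vertically by a unit.  Small
    blocks of cells (2x2, 3x2, 2x3 and a punctured 3x3) admit such permutations
    with any even number of horizontal moves.  An odd number of sums of order m
    or v is reached by reversing the sign used for the rows of w = 0 only: the
    columns are unchanged, but the three sums become +-2o, and o is free.

    Finally, the zero-sum matrix also writes each element of Gamma \ 2Gamma as
    a sum p + q with p and q both running through Gamma \ 2Gamma, so that any
    column can be split into two. *)

(** * Permutations of grid cells by horizontal and vertical moves *)

Definition cell := (nat * nat)%type.

Definition rect (a0 i0 p q : nat) : seq cell :=
  [seq (a, i) | a <- iota a0 p, i <- iota i0 q].

Definition gap (a b : nat) := (a - b) + (b - a).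

(** A zero gap is coprime only to 1, so a fixed cell counts as a move exactly when the modulus is
    1. *)
Definition hstep (m : nat) (u : cell * cell) :=
  (u.1.2 == u.2.2) && coprime (gap u.1.1 u.2.1) m.

Definition vstep (v : nat) (u : cell * cell) :=
  (u.1.1 == u.2.1) && coprime (gap u.1.2 u.2.2) v.

(** For duplicate-free [C], such a [P] is the graph of a permutation of [C]. *)
Definition routing (C : seq cell) (P : seq (cell * cell)) :=
  perm_eq (map fst P) C && perm_eq (map snd P) C.

Definition tiling (m v : nat) (C : seq cell) (h l : nat) : Prop :=
  exists PH PV, [/\ routing C (PH ++ PV), all (hstep m) PH, all (vstep v) PV,
                    size PH = h & size PV = l].

Definition flexible (m v : nat) (C : seq cell) : Prop :=
  forall h, h.*2 <= size C -> tiling m v C h.*2 (size C - h.*2).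

Definition shift (a0 i0 : nat) (w : cell) : cell := (a0 + w.1, i0 + w.2).

Definition shift2 a0 i0 (u : cell * cell) := (shift a0 i0 u.1, shift a0 i0 u.2).

(* [DH] and [DV] list the lengths of the horizontal and vertical moves. *)
Definition local_tiling (C : seq cell) (DH DV : seq nat) (h l : nat)
    (PH PV : seq (cell * cell)) :=
  [&& routing C (PH ++ PV),
      all (fun u : cell * cell => (u.1.2 == u.2.2) && (gap u.1.1 u.2.1 \in DH)) PH,
      all (fun u : cell * cell => (u.1.1 == u.2.1) && (gap u.1.2 u.2.2 \in DV)) PV,
      size PH == h & size PV == l].

(** Translation preserves gaps, so a block is treated once at the origin, where the boolean
    [local_tiling] is decided by computation. *)
Lemma local_tilingW m v a0 i0 C DH DV h l PH PV :
  all (coprime^~ m) DH -> all (coprime^~ v) DV ->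
  local_tiling C DH DV h l PH PV ->
  tiling m v (map (shift a0 i0) C) h l.
Proof.
move=> /allP hH /allP hV /and5P[/andP[r1 r2] /allP aH /allP aV /eqP <- /eqP <-].
exists (map (shift2 a0 i0) PH), (map (shift2 a0 i0) PV).
split; rewrite ?size_map //.
- rewrite /routing -map_cat -!map_comp.
  by rewrite (map_comp (shift a0 i0) fst) (map_comp (shift a0 i0) snd) !perm_map.
- rewrite all_map; apply/allP => u /aH /= /andP[/eqP e1 /hH h1].
  by rewrite /hstep /= e1 eqxx /gap !subnDl.
- rewrite all_map; apply/allP => u /aV /= /andP[/eqP e1 /hV h1].
  by rewrite /vstep /= e1 eqxx /gap !subnDl.
Qed.

Lemma rect_shift a0 i0 p q : rect a0 i0 p q = map (shift a0 i0) (rect 0 0 p q).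
Proof.
rewrite /rect map_allpairs -{1}[a0]addn0 iotaDl -{1}[i0]addn0 iotaDl.
by rewrite allpairs_mapl allpairs_mapr.
Qed.

Lemma size_rect a0 i0 p q : size (rect a0 i0 p q) = p * q.
Proof. by rewrite size_allpairs !size_iota. Qed.

Lemma rect_splitl a0 i0 p1 p2 q :
  rect a0 i0 (p1 + p2) q = rect a0 i0 p1 q ++ rect (a0 + p1) i0 p2 q.
Proof. by rewrite /rect iotaD allpairs_cat. Qed.

Lemma rect_splitr a0 i0 p q1 q2 :
  perm_eq (rect a0 i0 p (q1 + q2)) (rect a0 i0 p q1 ++ rect a0 (i0 + q1) p q2).
Proof. by rewrite /rect iotaD perm_allpairs_catr. Qed.

Lemma tiling_cat m v C1 C2 h1 h2 l1 l2 :
  tiling m v C1 h1 l1 -> tiling m v C2 h2 l2 ->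
  tiling m v (C1 ++ C2) (h1 + h2) (l1 + l2).
Proof.
move=> [H1 [V1 [/andP[r1 r1'] aH1 aV1 <- <-]]] [H2 [V2 [/andP[r2 r2'] aH2 aV2 <- <-]]].
exists (H1 ++ H2), (V1 ++ V2); split; rewrite ?size_cat ?all_cat ?aH1 ?aV1 //.
have p : perm_eq ((H1 ++ H2) ++ (V1 ++ V2)) ((H1 ++ V1) ++ (H2 ++ V2)).
  by rewrite -!catA perm_cat2l perm_catCA.
apply/andP; split; apply: (perm_trans (perm_map _ p)); rewrite map_cat perm_cat //.
Qed.

Lemma tiling_perm m v C C' h l : perm_eq C C' -> tiling m v C h l -> tiling m v C' h l.
Proof.
move=> p [H [V [/andP[r r'] aH aV e e']]]; exists H, V; split => //.
by rewrite /routing !(perm_trans _ p).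
Qed.

Lemma flexible_perm m v C C' : perm_eq C C' -> flexible m v C -> flexible m v C'.
Proof. by move=> p f h; rewrite -(perm_size p) => /f; apply: tiling_perm. Qed.

(** Horizontal moves are given to [C1] until it is full, then to [C2]. As [C1] has even size, it can
    be filled completely by pairs. *)
Lemma flexible_cat m v C1 C2 : ~~ odd (size C1) ->
  flexible m v C1 -> flexible m v C2 -> flexible m v (C1 ++ C2).
Proof.
move=> e1 f1 f2 h; rewrite size_cat => le.
pose h1 := minn h (size C1)./2; pose h2 := h - h1.
have l1 : h1.*2 <= size C1 by rewrite /h1; lia.
have l2 : h2.*2 <= size C2 by rewrite /h2 /h1; lia.
have := tiling_cat (f1 _ l1) (f2 _ l2).
have -> : h1.*2 + h2.*2 = h.*2 by rewrite /h2 /h1; lia.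
by have -> : size C1 - h1.*2 + (size C2 - h2.*2) = size C1 + size C2 - h.*2
  by move: le l1 l2; rewrite /h2 /h1; lia.
Qed.

Lemma flexible_nil m v : flexible m v [::].
Proof. by move=> [|h] // _; exists [::], [::]; split. Qed.

Lemma flexible_shift m v a0 i0 C DH DV :
  all (coprime^~ m) DH -> all (coprime^~ v) DV ->
  (forall h, h.*2 <= size C -> exists PH PV, local_tiling C DH DV h.*2 (size C - h.*2) PH PV) ->
  flexible m v (map (shift a0 i0) C).
Proof.
move=> hH hV H h; rewrite size_map => /H[PH [PV t]].
exact: (local_tilingW _ _ hH hV t).
Qed.


(** Two parallel swaps give 0 or 4 horizontal moves; the 4-cycle around the square gives 2. *)
Lemma flexible_2x2 m v a0 i0 : flexible m v (rect a0 i0 2 2).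
Proof.
rewrite rect_shift; apply: (@flexible_shift _ _ _ _ _ [:: 1] [:: 1]); rewrite /= ?coprime1n //.
case=> [|[|[|h]]] // _.
- by exists [::], [:: ((0,0),(0,1)); ((0,1),(0,0)); ((1,0),(1,1)); ((1,1),(1,0))].
- by exists [:: ((0,0),(1,0)); ((1,1),(0,1))], [:: ((1,0),(1,1)); ((0,1),(0,0))].
- by exists [:: ((0,0),(1,0)); ((1,0),(0,0)); ((0,1),(1,1)); ((1,1),(0,1))], [::].
Qed.

(** A 2x2 block beside a vertical swap, except that 6 horizontal moves come from two 3-cycles. These
    contain moves of length 2, hence [odd m]. *)
Lemma flexible_3x2 m v a0 i0 : odd m -> flexible m v (rect a0 i0 3 2).
Proof.
move=> om; rewrite rect_shift.
apply: (@flexible_shift _ _ _ _ _ [:: 1; 2] [:: 1]); rewrite /= ?coprime1n ?coprime2n ?om //.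
pose V2 := [:: ((2,0),(2,1)); ((2,1),(2,0))] : seq (cell * cell).
case=> [|[|[|[|h]]]] // _.
- by exists [::], ([:: ((0,0),(0,1)); ((0,1),(0,0)); ((1,0),(1,1)); ((1,1),(1,0))] ++ V2).
- by exists [:: ((0,0),(1,0)); ((1,1),(0,1))], ([:: ((1,0),(1,1)); ((0,1),(0,0))] ++ V2).
- by exists [:: ((0,0),(1,0)); ((1,0),(0,0)); ((0,1),(1,1)); ((1,1),(0,1))], V2.
- by exists [:: ((0,0),(1,0)); ((1,0),(2,0)); ((2,0),(0,0));
                ((0,1),(1,1)); ((1,1),(2,1)); ((2,1),(0,1))], [::].
Qed.

Lemma flexible_2x3 m v a0 i0 : odd v -> flexible m v (rect a0 i0 2 3).
Proof.
move=> ov; rewrite rect_shift.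
apply: (@flexible_shift _ _ _ _ _ [:: 1] [:: 1; 2]); rewrite /= ?coprime1n ?coprime2n ?ov //.
pose H2 := [:: ((0,2),(1,2)); ((1,2),(0,2))] : seq (cell * cell).
case=> [|[|[|[|h]]]] // _.
- by exists [::], [:: ((0,0),(0,1)); ((0,1),(0,2)); ((0,2),(0,0));
                      ((1,0),(1,1)); ((1,1),(1,2)); ((1,2),(1,0))].
- by exists H2, [:: ((0,0),(0,1)); ((0,1),(0,0)); ((1,0),(1,1)); ((1,1),(1,0))].
- by exists ([:: ((0,0),(1,0)); ((1,1),(0,1))] ++ H2), [:: ((1,0),(1,1)); ((0,1),(0,0))].
- by exists ([:: ((0,0),(1,0)); ((1,0),(0,0)); ((0,1),(1,1)); ((1,1),(0,1))] ++ H2), [::].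
Qed.

(** With no horizontal move, each column [a] is permuted in itself. Otherwise (1,0) and (2,0) are
    swapped, and the other six cells form a 3x2 block. *)
Lemma flexible_3x3_punctured m v : odd m -> odd v -> flexible m v (behead (rect 0 0 3 3)).
Proof.
move=> om ov; rewrite -[behead _](@map_id) (@eq_map _ _ id (shift 0 0)); last by case.
apply: (@flexible_shift _ _ _ _ _ [:: 1; 2] [:: 1; 2]); rewrite /= ?coprime1n ?coprime2n ?om ?ov //.
pose H0 := [:: ((1,0),(2,0)); ((2,0),(1,0))] : seq (cell * cell).
pose V2 := [:: ((2,1),(2,2)); ((2,2),(2,1))] : seq (cell * cell).
case=> [|[|[|[|[|h]]]]] // _.
- by exists [::], ([:: ((0,1),(0,2)); ((0,2),(0,1)); ((1,0),(1,1)); ((1,1),(1,2)); ((1,2),(1,0));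
     ((2,0),(2,1)); ((2,1),(2,2)); ((2,2),(2,0))]).
- by exists H0, ([:: ((0,1),(0,2)); ((0,2),(0,1)); ((1,1),(1,2)); ((1,2),(1,1))] ++ V2).
- by exists ([:: ((0,1),(1,1)); ((1,2),(0,2))] ++ H0), ([:: ((1,1),(1,2)); ((0,2),(0,1))] ++ V2).
- by exists ([:: ((0,1),(1,1)); ((1,1),(0,1)); ((0,2),(1,2)); ((1,2),(0,2))] ++ H0), V2.
- by exists ([:: ((0,1),(1,1)); ((1,1),(2,1)); ((2,1),(0,1));
                 ((0,2),(1,2)); ((1,2),(2,2)); ((2,2),(0,2))] ++ H0), [::].
Qed.

(** As the first modulus is 1, fixed cells serve as the horizontal moves. *)
Lemma flexible_1x2 v a0 i0 : flexible 1 v (rect a0 i0 1 2).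
Proof.
rewrite rect_shift; apply: (@flexible_shift _ _ _ _ _ [:: 0] [:: 1]); rewrite /= ?coprime1n //.
case=> [|[|h]] // _.
- by exists [::], [:: ((0,0),(0,1)); ((0,1),(0,0))].
- by exists [:: ((0,0),(0,0)); ((0,1),(0,1))], [::].
Qed.

Lemma flexible_2x1 m a0 i0 : flexible m 1 (rect a0 i0 2 1).
Proof.
rewrite rect_shift; apply: (@flexible_shift _ _ _ _ _ [:: 1] [:: 0]); rewrite /= ?coprime1n //.
case=> [|[|h]] // _.
- by exists [::], [:: ((0,0),(0,0)); ((1,0),(1,0))].
- by exists [:: ((0,0),(1,0)); ((1,0),(0,0))], [::].
Qed.

Lemma flexible_strip m v a0 i0 p q :
  (forall a, flexible m v (rect a i0 2 q)) -> flexible m v (rect a0 i0 p.*2 q).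
Proof.
move=> H; elim: p a0 => [|p IH] a0; first by apply: flexible_nil.
by rewrite doubleS -(addn2 _.*2) addnC rect_splitl; apply: flexible_cat; rewrite ?size_rect ?oddM.
Qed.

Lemma flexible_width2 m v a0 i0 p : odd m -> (p != 1) || (m == 1) ->
  flexible m v (rect a0 i0 p 2).
Proof.
move=> om hp; rewrite -(odd_double_half p); case op: (odd p) => /=; last first.
  by apply: flexible_strip => a; apply: flexible_2x2.
case: (posnP p./2) hp => [e|p2 _].
  have -> : p = 1 by lia.
  by move=> /= /eqP ->; apply: flexible_1x2.
(* An odd length of at least 3 is cut into one 3x2 block and 2x2 blocks. *)
have -> : 1 + p./2.*2 = 3 + p./2.-1.*2 by lia.
rewrite rect_splitl; apply: flexible_cat; rewrite ?size_rect //; first exact: flexible_3x2.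
by apply: flexible_strip => a; apply: flexible_2x2.
Qed.

Lemma flexible_rect m v a0 i0 p q : odd m -> (p != 1) || (m == 1) -> ~~ odd q ->
  flexible m v (rect a0 i0 p q).
Proof.
move=> om hp eq; rewrite -[q]even_halfK //.
elim: (q./2) i0 => [|r IH] i0.
  by rewrite (size0nil (s := rect _ _ _ _)) ?size_rect ?muln0 //; apply: flexible_nil.
rewrite doubleS -(addn2 _.*2) addnC.
apply: (flexible_perm (C := rect a0 i0 p 2 ++ rect a0 (i0 + 2) p r.*2)).
  by rewrite perm_sym rect_splitr.
by apply: flexible_cat; rewrite ?size_rect ?oddM ?andbF //; apply: flexible_width2.
Qed.

Lemma flexible_punctured m v : odd m -> odd v -> exists C : seq cell,
  perm_eq (rect 0 0 m v) ((0, 0) :: C) /\ flexible m v C.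
Proof.
move=> om ov.
have [m1|m1] := eqVneq m 1.
  exists (rect 0 1 m v.-1); split; last by apply: flexible_rect; rewrite ?m1 ?eqxx ?orbT //; lia.
  have {1}-> : v = 1 + v.-1 by lia.
  by apply: (perm_trans (rect_splitr _ _ _ _ _)); rewrite m1.
have [v1|v1] := eqVneq v 1.
  exists (rect 1 0 m.-1 v); split; last first.
    have -> : m.-1 = m.-1./2.*2 by lia.
    by rewrite v1; apply: flexible_strip => a; apply: flexible_2x1.
  have {1}-> : m = 1 + m.-1 by lia.
  by rewrite rect_splitl v1.
(* Both sides are now at least 3: a punctured corner, a strip of 2x3 blocks, and a rectangle of even
   width [v - 3]. *)
exists ((behead (rect 0 0 3 3) ++ rect 3 0 (m - 3) 3) ++ rect 0 3 m (v - 3)); split.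
  have e : (0,0) :: ((behead (rect 0 0 3 3) ++ rect 3 0 (m - 3) 3) ++ rect 0 3 m (v - 3)) =
     (rect 0 0 3 3 ++ rect 3 0 (m - 3) 3) ++ rect 0 3 m (v - 3) by [].
  rewrite e -(rect_splitl 0 0 3) (_ : 3 + (m - 3) = m); last by lia.
  have {1}-> : v = 3 + (v - 3) by lia.
  exact: rect_splitr.
have e1 : ~~ odd (size (rect 3 0 (m - 3) 3)) by rewrite size_rect; lia.
apply: flexible_cat; first by rewrite size_cat oddD (negbTE e1).
  apply: flexible_cat => //; first exact: flexible_3x3_punctured.
  have -> : m - 3 = (m - 3)./2.*2 by lia.
  by apply: flexible_strip => a; apply: flexible_2x3.
by apply: flexible_rect => //; [rewrite m1|lia].
Qed.

(** With [m * v] even, removing one cell would leave an odd number. The removed domino will carry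
    one sum of each order. *)
Lemma flexible_minus_domino m v : odd m -> ~~ odd v -> 0 < v -> exists C : seq cell,
  perm_eq (rect 0 0 m v) [:: (0, 0), (0, 1) & C] /\ flexible m v C.
Proof.
move=> om ev v0; exists (rect 1 0 m.-1 2 ++ rect 0 2 m (v - 2)); split.
  have e : [:: (0, 0), (0, 1) & rect 1 0 m.-1 2 ++ rect 0 2 m (v - 2)] =
     (rect 0 0 1 2 ++ rect 1 0 m.-1 2) ++ rect 0 2 m (v - 2) by [].
  rewrite e -(rect_splitl 0 0 1) (_ : 1 + m.-1 = m); last by lia.
  have {1}-> : v = 2 + (v - 2) by lia.
  exact: rect_splitr.
apply: flexible_cat; first by rewrite size_rect oddM andbF.
  have -> : m.-1 = m.-1./2.*2 by lia.
  by apply: flexible_strip => a; apply: flexible_2x2.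
by have [->|m1] := eqVneq m 1; apply: flexible_rect => //; rewrite ?m1 //; lia.
Qed.

(** * Integer coordinates and orders in the dihedral group *)

Definition vec (m N : nat) (a b : int) (t : bool) : elt :=
  (`|(a %% m)%Z|%N, `|(b %% N)%Z|%N, t).

Lemma absz_modz_addn (m : nat) (a b : int) : 0 < m ->
  (`|(a %% m)%Z| + `|(b %% m)%Z|) %% m = `|((a + b)%R %% m)%Z|.
Proof.
move=> m0; have mn0 : Posz m != 0 by lia.
apply: (@can_inj _ _ Posz absz) => //.
by rewrite -modz_nat PoszD !gez0_abs ?modz_ge0 // modzDm.
Qed.

Lemma absz_modz_subn (m : nat) (a b : int) : 0 < m ->
  (`|(a %% m)%Z| + (m - `|(b %% m)%Z|)) %% m = `|((a - b)%R %% m)%Z|.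
Proof.
move=> m0; have mn0 : Posz m != 0 by lia.
have lt : (`|(b %% m)%Z| <= m)%N.
  by have := ltz_mod b mn0; have := modz_ge0 b mn0; lia.
apply: (@can_inj _ _ Posz absz) => //.
rewrite -modz_nat PoszD -subzn // !gez0_abs ?modz_ge0 //.
by rewrite addrCA modzDl modzDml -modzDmr modzNm modzDmr.
Qed.

Lemma gadd_vec m N a b t a' b' t' : 0 < m -> 0 < N ->
  gadd m N (vec m N a b t) (vec m N a' b' t') =
  vec m N (a + (if t then - a' else a'))%R (b + (if t then - b' else b'))%R (t (+) t').
Proof.
move=> m0 N0; rewrite /gadd /vec; case: t => /=.
  by rewrite !absz_modz_subn.
by rewrite !absz_modz_addn.
Qed.

Lemma vec_eq m N a b t a' b' t' : 0 < m -> 0 < N ->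
  (vec m N a b t == vec m N a' b' t') =
  [&& (m %| (a - a')%R)%Z, (N %| (b - b')%R)%Z & t == t'].
Proof.
move=> m0 N0; rewrite /vec !xpair_eqE -andbA -!eqz_mod_dvd.
have E (d : nat) x y : (0 < d)%N -> (`|(x %% d)%Z|%N == `|(y %% d)%Z|%N) = (x == y %[mod d])%Z.
  move=> d0; have dn0 : Posz d != 0 by lia.
  by rewrite -eqz_nat !gez0_abs ?modz_ge0.
by rewrite !E.
Qed.

Lemma gzero_vec m N : gzero = vec m N 0 0 false.
Proof. by rewrite /vec !mod0z. Qed.

Lemma gmul_vec m N d a b : 0 < m -> 0 < N ->
  gmul m N d (vec m N a b false) = vec m N (a *+ d)%R (b *+ d)%R false.
Proof.
move=> m0 N0; rewrite /gmul; elim: d => [|d IH]; first exact: gzero_vec.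
by rewrite iterS IH gadd_vec //= -!mulrS.
Qed.

Lemma gmul_vec_eq0 m N d a b : 0 < m -> 0 < N ->
  (gmul m N d (vec m N a b false) == gzero) =
  (m %| (a *+ d)%R)%Z && (N %| (b *+ d)%R)%Z.
Proof. by move=> m0 N0; rewrite gmul_vec // (gzero_vec m N) vec_eq // !subr0 andbT. Qed.

Lemma gorder_vecN m N a b : 0 < m -> 0 < N ->
  gorder m N (vec m N (- a) (- b) false) = gorder m N (vec m N a b false).
Proof.
move=> m0 N0; rewrite /gorder; congr _.+1; apply: eq_find => d.
by rewrite !gmul_vec_eq0 // !mulNrn !dvdzE !abszN.
Qed.

(** The bound on [k] places it in the range searched by [gorder], so that [find] succeeds. *)
Lemma gorder_eq m N a b k : 0 < m -> 0 < N -> 0 < k <= 2 * m * N ->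
  (forall d : nat, (m %| (a *+ d)%R)%Z && (N %| (b *+ d)%R)%Z = (k %| d)) ->
  gorder m N (vec m N a b false) = k.
Proof.
move=> m0 N0 /andP[k0 kL] H; rewrite /gorder.
rewrite (eq_find (a2 := fun d => k %| d)); last by move=> d; rewrite gmul_vec_eq0 // H.
set s := iota _ _; have hs : has (fun d => k %| d) s.
  by apply/hasP; exists k => //; rewrite mem_iota; lia.
have lt := hs; rewrite has_find size_iota in lt.
have := nth_find 0 hs; rewrite nth_iota // => /dvdn_leq le1.
apply/eqP; rewrite eqn_leq; apply/andP; split; last by apply: le1.
rewrite leqNgt; apply/negP => lt'.
(* The search list starts at 1, so [k] has index [k.-1]. *)
have := @before_find _ 0 (fun d => k %| d) s k.-1.
rewrite nth_iota; last by lia.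
have e1 : 1 + k.-1 = k by lia.
by rewrite e1 dvdnn => H1; have := H1 ltac:(lia).
Qed.

Lemma gorder_horizontal m N a b : 0 < m -> 0 < N -> coprime `|a| m -> (N %| b)%Z ->
  gorder m N (vec m N a b false) = m.
Proof.
move=> m0 N0 ca db; apply: gorder_eq => // [|d]; first by rewrite m0 /=; nia.
rewrite -[(a *+ d)%R]mulr_natr -[(b *+ d)%R]mulr_natr (dvdz_mulr _ db) andbT.
by rewrite dvdzE abszM Gauss_dvdr ?natz // coprime_sym.
Qed.

Lemma gorder_vertical m v a e : 0 < m -> 0 < v -> (m %| a)%Z -> coprime `|e| v ->
  gorder m (2 * v) (vec m (2 * v) a (2 * e)%R false) = v.
Proof.
move=> m0 v0 da ce; apply: gorder_eq => // [||d]; [lia|nia|].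
rewrite -[(a *+ d)%R]mulr_natr (dvdz_mulr _ da) /= -[(2 * e *+ d)%R]mulr_natr.
rewrite PoszM -mulrA -[2%R]/(Posz 2) dvdz_mul2l //.
by rewrite dvdzE abszM Gauss_dvdr ?natz // coprime_sym.
Qed.

(** * Membership and cardinality *)

Lemma mem_Gamma m N x : (x \in Gamma m N) = (x.1.1 < m) && (x.1.2 < N).
Proof.
case: x => [[a b] t] /=; apply/flattenP/idP.
  move=> [s /mapP[a' ha ->] /allpairsP[[b' t'] /= [hb _ [-> -> _]]]].
  by rewrite !mem_iota !add0n /= in ha hb; rewrite ha hb.
move=> /andP[ha hb]; exists [seq (a, b, t) | b <- iota 0 N, t <- [:: false; true]].
  by apply: map_f; rewrite mem_iota.
by apply/allpairsP; exists (b, t); split => //=; [rewrite mem_iota|case: t].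
Qed.

Lemma Gamma_uniq m N : uniq (Gamma m N).
Proof.
have -> : Gamma m N = [seq (a, y.1, y.2) | a <- iota 0 m,
    y <- [seq (b, t) | b <- iota 0 N, t <- [:: false; true]]].
  by rewrite /Gamma; congr flatten; apply: eq_map => a; rewrite map_allpairs.
apply: allpairs_uniq; rewrite ?iota_uniq //.
  by apply: allpairs_uniq; rewrite ?iota_uniq // => -[? ?] [? ?].
by move=> [a [b t]] [a' [b' t']] _ _ /= [-> -> ->].
Qed.

Lemma mem_rect0 m v w : (w \in rect 0 0 m v) = (w.1 < m) && (w.2 < v).
Proof.
case: w => a i; apply/allpairsP/idP => [[[a' i'] /= [+ + [-> ->]]]|].
  by rewrite !mem_iota /= => -> ->.
by move=> /andP[/= ha hi]; exists (a, i); rewrite !mem_iota.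
Qed.

Lemma rect_uniq a0 i0 p q : uniq (rect a0 i0 p q).
Proof. by apply: allpairs_uniq; rewrite ?iota_uniq // => -[? ?] [? ?]. Qed.

(** The upper bound suffices: it forces any [3 * (m * v)] distinct elements of the set to exhaust
    it. *)
Lemma size_Gamma_minus_2Gamma m v :
  size (Gamma_minus_2Gamma m (2 * v)) <= 3 * (m * v).
Proof.
pose f (b : bool) (t : bool) (w : cell) : elt := (w.1, 2 * w.2 + b, t).
pose r := rect 0 0 m v.
pose L := map (f true false) r ++ map (f false true) r ++ map (f true true) r.
have -> : 3 * (m * v) = size L by rewrite !size_cat !size_map size_rect; lia.
apply: uniq_leq_size; first by rewrite filter_uniq // Gamma_uniq.
move=> [[a b] t]; rewrite mem_filter mem_Gamma /= => /and3P[tb am bN].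
have -> : (a, b, t) = f (odd b) t (a, b./2) by rewrite /f /=; congr (_, _, _); lia.
have rw : (a, b./2) \in r by rewrite mem_rect0 /=; lia.
rewrite !mem_cat; case: t tb => /= [_|ob]; last by rewrite ob map_f.
by case: (odd b); rewrite map_f ?orbT.
Qed.

(** Reduction modulo the even number [2 * v] preserves parity. *)
Lemma vec_in_Gamma_minus_2Gamma m v a b t : 0 < m -> 0 < v ->
  (vec m (2 * v) a b t \in Gamma_minus_2Gamma m (2 * v)) = t || odd `|b|.
Proof.
move=> m0 v0; rewrite mem_filter mem_Gamma /=.
have mn : Posz m != 0 by lia.
have Nn : Posz (2 * v) != 0 by lia.
have h1 : `|(a %% m)%Z| < m by have := ltz_mod a mn; have := modz_ge0 a mn; lia.
have h2 : `|(b %% (2 * v)%N)%Z| < 2 * v.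
  by have := ltz_mod b Nn; have := modz_ge0 b Nn; lia.
rewrite h1 h2 !andbT; case: t => //=.
have := divz_eq b (2 * v)%N; have := modz_ge0 b Nn.
set q := (b %/ _)%Z; set r := (b %% _)%Z => r0 e.
have {}e : b = (2 * (q * Posz v) + r)%R by rewrite {1}e PoszM; ring.
by move: e; set z := (q * _)%R => e; lia.
Qed.

(** * The three letters of a cell *)

(** For even [v], the value of 4i modulo 2v is the same at i and i + v/2; opposite signs on the two
    halves keep the letters distinct. *)
Definition positive_half (v : nat) (w : cell) : bool := odd v || (w.2 < v./2).

Definition signed (b : bool) (x : int) : int := (if b then x else - x)%R.

(** The flag [neg] negates all these letters at once; [split_Gamma_minus_2Gamma] needs the negated
    version. *)
Definition ptA (m v : nat) (oa ob : int) (neg : bool) (w : cell) : elt :=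
  let b := positive_half v w (+) neg in
  vec m (2 * v) (signed b (oa + 2 * Posz w.1)%R) (signed b (ob + 4 * Posz w.2)%R) false.

Definition ptB (m v : nat) (w : cell) : elt :=
  vec m (2 * v) (- Posz w.1)%R (- (2 * Posz w.2))%R true.

Definition ptC (m v : nat) (oa ob : int) (w : cell) : elt :=
  vec m (2 * v) (oa + Posz w.1)%R (ob + 2 * Posz w.2)%R true.

Lemma eq_of_dvdz_sub (m a b : nat) : a < m -> b < m ->
  (m %| (Posz a - Posz b)%R)%Z -> a = b.
Proof. by move=> am bm; rewrite -eqz_mod_dvd !modz_nat eqz_nat !modn_small // => /eqP. Qed.

Lemma dvdz_double (v : nat) (x : int) : (Posz (2 * v) %| (2 * x)%R)%Z = (v %| x)%Z.
Proof. by rewrite PoszM -[2%R]/(Posz 2) dvdz_mul2l. Qed.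

Lemma dvdz_double_odd (m : nat) (x : int) : odd m -> (m %| (2 * x)%R)%Z = (m %| x)%Z.
Proof. by move=> om; rewrite -[2%R]/(Posz 2) Gauss_dvdzr // coprimezE /= coprimen2. Qed.

Lemma dvdz_signed (d : int) b x y : 
  (d %| (signed b x - signed b y)%R)%Z = (d %| (x - y)%R)%Z.
Proof.
by case: b => //=; rewrite (_ : (- x - - y)%R = (- (x - y))%R) ?dvdzE ?abszN //; ring.
Qed.

Lemma ptA_inj m v oa ob neg : odd m -> 0 < v -> odd `|ob| ->
  {in rect 0 0 m v &, injective (ptA m v oa ob neg)}.
Proof.
move=> om v0 oob [a i] [a' i']; rewrite !mem_rect0 /= => /andP[am iv] /andP[am' iv'] /eqP.
have m0 : 0 < m by case: (m) om.
rewrite /ptA /= vec_eq //; last by lia.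
set h := positive_half v (a, i); set h' := positive_half v (a', i').
have [hh|hh] := eqVneq h h'; last first.
  (* Opposite signs: the second coordinates differ by twice the odd number ob + 2(i + i') up to
     sign, which the even number [v] would have to divide. *)
  move=> /and3P[_ d _]; exfalso.
  have ov : ~~ odd v by move: hh; rewrite /h /h' /positive_half; case: odd.
  have {d} : (Posz (2 * v) %| (2 * (ob + 2 * (Posz i + Posz i')))%R)%Z.
    move: d; rewrite (_ : h' = ~~ h); last by move: hh; case: h; case: h'.
    set e := (_ - _)%R => d.
    have [->|->] : (2 * (ob + 2 * (Posz i + Posz i')))%R = e \/
        (2 * (ob + 2 * (Posz i + Posz i')))%R = (- e)%R => //.
      by rewrite /e; case: h {hh e d}; case: neg => /=; [right|left|left|right]; ring.
    by rewrite dvdzE abszN.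
  rewrite dvdz_double => /dvdzP[q e].
  have ev : v = 2 * v./2 by lia.
  move: e; rewrite ev PoszM mulrCA.
  by set z := (q * _)%R; lia.
rewrite hh !dvdz_signed => /and3P[d1 d2 _].
have ea : a = a'.
  apply: (eq_of_dvdz_sub am am'); rewrite -dvdz_double_odd //.
  by move: d1; congr (_ %| _)%Z; ring.
have {}d2 : (Posz v %| (2 * (Posz i - Posz i'))%R)%Z.
  by rewrite -dvdz_double; move: d2; congr (_ %| _)%Z; ring.
congr pair => //; case ov: (odd v).
  by apply: (eq_of_dvdz_sub iv iv'); rewrite -dvdz_double_odd.
have ev : v = 2 * v./2 by lia.
move: d2; rewrite {1}ev dvdz_double => d2.
move: hh; rewrite /h /h' /positive_half ov /=.
have [li|li] := ltnP i v./2; have [li'|li'] := ltnP i' v./2 => // _.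
  exact: (eq_of_dvdz_sub li li').
suff : i - v./2 = i' - v./2 by lia.
apply: (@eq_of_dvdz_sub v./2); [lia|lia|].
by move: d2; congr (_ %| _)%Z; lia.
Qed.

Lemma ptB_inj m v : 0 < m -> 0 < v -> {in rect 0 0 m v &, injective (ptB m v)}.
Proof.
move=> m0 v0 [a i] [a' i']; rewrite !mem_rect0 /= => /andP[am iv] /andP[am' iv'] /eqP.
rewrite /ptB /= vec_eq ?muln_gt0 ?v0 // => /and3P[d1 d2 _].
have ea : a' = a by apply: (eq_of_dvdz_sub am' am); move: d1; congr (_ %| _)%Z; ring.
have ei : i' = i.
  by apply: (eq_of_dvdz_sub iv' iv); rewrite -dvdz_double; move: d2; congr (_ %| _)%Z; ring.
by rewrite ea ei.
Qed.

Lemma ptC_inj m v oa ob : 0 < m -> 0 < v -> {in rect 0 0 m v &, injective (ptC m v oa ob)}.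
Proof.
move=> m0 v0 [a i] [a' i']; rewrite !mem_rect0 /= => /andP[am iv] /andP[am' iv'] /eqP.
rewrite /ptC /= vec_eq ?muln_gt0 ?v0 // => /and3P[d1 d2 _].
have ea : a = a' by apply: (eq_of_dvdz_sub am am'); move: d1; congr (_ %| _)%Z; ring.
have ei : i = i'.
  by apply: (eq_of_dvdz_sub iv iv'); rewrite -dvdz_double; move: d2; congr (_ %| _)%Z; ring.
by rewrite ea ei.
Qed.

Definition letters m v oa ob neg : seq elt :=
  map (ptA m v oa ob neg) (rect 0 0 m v) ++ map (ptB m v) (rect 0 0 m v)
  ++ map (ptC m v oa ob) (rect 0 0 m v).

(** The flag tau and the parity of the second coordinate separate the three families; distinctness
    and counting do the rest. *)
Lemma perm_letters m v oa ob neg : odd m -> 0 < v -> odd `|ob| ->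
  perm_eq (letters m v oa ob neg) (Gamma_minus_2Gamma m (2 * v)).
Proof.
move=> om v0 oob; have m0 : 0 < m by case: (m) om.
have N0 : 0 < 2 * v by lia.
have sz : size (letters m v oa ob neg) = 3 * (m * v).
  by rewrite !size_cat !size_map size_rect; lia.
have sub : {subset letters m v oa ob neg <= Gamma_minus_2Gamma m (2 * v)}.
  move=> x; rewrite !mem_cat => /or3P[] /mapP[w _ ->];
    rewrite vec_in_Gamma_minus_2Gamma //=.
  by case: (_ (+) _) => /=; lia.
have un : uniq (letters m v oa ob neg).
  rewrite !cat_uniq !map_inj_in_uniq ?rect_uniq /=.
  - rewrite andbT; apply/andP; split.
      apply/hasPn => x; rewrite mem_cat => /orP[] /mapP[w _ ->]; apply/negP => /mapP[w' _ /eqP];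
        by rewrite vec_eq //= !andbF.
    apply/hasPn => x /mapP[w _ ->]; apply/negP => /mapP[w' _ /eqP].
    rewrite vec_eq // => /and3P[_ /dvdzP[q e] _]; move: e; rewrite PoszM mulrCA.
    by set z := (q * _)%R; lia.
  - exact: ptC_inj.
  - exact: ptB_inj.
  - exact: ptA_inj.
apply: uniq_perm => //; first by rewrite filter_uniq // Gamma_uniq.
by have [|_ e] := uniq_min_size un sub; first by rewrite sz size_Gamma_minus_2Gamma.
Qed.

(** * Three classes of rows, their columns and their sums *)

(** The choice [c] only exchanges values between the two lists. This is why the order chosen by [s]
    in the rows never affects the columns. *)
Lemma perm_choose (T : Type) (T' : eqType) (c : T -> bool) (f g : T -> T') (s : seq T) :
  perm_eq ([seq if c x then f x else g x | x <- s] ++ [seq if c x then g x else f x | x <- s])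
          (map f s ++ map g s).
Proof.
apply/permP => p; rewrite !count_cat !count_map.
elim: s => //= x s; case: (c x); lia.
Qed.

(* The column of the C-entry of a row determines its class.  The C-entry is
   taken at the second cell of [u], the two other entries at the first one. *)
Definition row1 m v oa ob (s : cell -> bool) (u : cell * cell) :=
  let x := ptA m v oa ob false u.1 in let y := ptB m v u.1 in
  let z := ptC m v oa ob u.2 in if s u.1 then (z, x, y) else (z, y, x).

Definition row2 m v oa ob (s : cell -> bool) (u : cell * cell) :=
  let x := ptA m v oa ob false u.1 in let y := ptB m v u.1 in
  let z := ptC m v oa ob u.2 in if s u.1 then (y, z, x) else (x, z, y).

Definition row3 m v oa ob (s : cell -> bool) (u : cell * cell) :=
  let x := ptA m v oa ob false u.1 in let y := ptB m v u.1 in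
  let z := ptC m v oa ob u.2 in if s u.1 then (x, y, z) else (y, x, z).

Definition rows m v oa ob s P1 P2 P3 :=
  map (row3 m v oa ob s) P3 ++ map (row2 m v oa ob s) P2 ++ map (row1 m v oa ob s) P1.

Lemma map_if_fst (T : Type) (c : cell -> bool) (f g : cell -> T) (h : cell * cell -> T) P :
  (forall u, h u = if c u.1 then f u.1 else g u.1) ->
  map h P = [seq if c x then f x else g x | x <- map fst P].
Proof. by move=> H; rewrite -map_comp; apply: eq_map. Qed.

Lemma map_snd_comp (T : Type) (f : cell -> T) (h : cell * cell -> T) P :
  (forall u, h u = f u.2) -> map h P = map f (map snd P).
Proof. by move=> H; rewrite -map_comp; apply: eq_map. Qed.

Lemma perm_letter_columns (C : seq cell) (T : eqType) (c : cell -> bool) (f g k : cell -> T)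
    (Q1 Q2 Q3 : seq cell) :
  perm_eq Q1 C -> perm_eq Q2 C -> perm_eq Q3 C ->
  perm_eq ([seq if c x then f x else g x | x <- Q1] ++
           [seq if c x then g x else f x | x <- Q2] ++ map k Q3)
    (map f C ++ map g C ++ map k C).
Proof.
move=> p1 p2 p3; rewrite !catA perm_cat ?perm_map //.
apply: perm_trans (perm_choose c f g C).
by rewrite perm_cat ?perm_map.
Qed.

Lemma rows_columns m v oa ob s P1 P2 P3 (C := rect 0 0 m v)
    (R := rows m v oa ob s P1 P2 P3) (S := Gamma_minus_2Gamma m (2 * v)) :
  odd m -> 0 < v -> odd `|ob| -> routing C P1 -> routing C P2 -> routing C P3 ->
  [/\ perm_eq [seq r.1.1 | r <- R] S, perm_eq [seq r.1.2 | r <- R] S &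
      perm_eq [seq r.2 | r <- R] S].
Proof.
move=> om v0 oob /andP[a1 b1] /andP[a2 b2] /andP[a3 b3].
have L := perm_letters oa false om v0 oob.
split; rewrite /R /rows !map_cat -!map_comp; apply: perm_trans L; rewrite /letters.
- rewrite (map_if_fst (c := s) (f := ptA m v oa ob false) (g := ptB m v)); last first.
    by move=> u /=; rewrite /row3; case: (s _).
  rewrite (map_if_fst (c := s) (f := ptB m v) (g := ptA m v oa ob false)); last first.
    by move=> u /=; rewrite /row2; case: (s _).
  rewrite (map_snd_comp (f := ptC m v oa ob)); last first.
    by move=> u /=; rewrite /row1; case: (s _).
  exact: perm_letter_columns.
- rewrite (map_if_fst (c := s) (f := ptB m v) (g := ptA m v oa ob false) P3); last first.
    by move=> u /=; rewrite /row3; case: (s _).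
  rewrite (map_if_fst (c := s) (f := ptA m v oa ob false) (g := ptB m v) P1); last first.
    by move=> u /=; rewrite /row1; case: (s _).
  rewrite (map_snd_comp (f := ptC m v oa ob)); last first.
    by move=> u /=; rewrite /row2; case: (s _).
  by rewrite catA perm_catC; apply: perm_letter_columns.
- rewrite (map_if_fst (c := s) (f := ptA m v oa ob false) (g := ptB m v) P2); last first.
    by move=> u /=; rewrite /row2; case: (s _).
  rewrite (map_if_fst (c := s) (f := ptB m v) (g := ptA m v oa ob false) P1); last first.
    by move=> u /=; rewrite /row1; case: (s _).
  rewrite (map_snd_comp (f := ptC m v oa ob)); last first.
    by move=> u /=; rewrite /row3; case: (s _).
  by rewrite perm_catC -catA; apply: perm_letter_columns.
Qed.

Local Arguments gadd : simpl never.

Definition sum3 (m N : nat) (r : elt * elt * elt) : elt :=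
  gadd m N (gadd m N r.1.1 r.1.2) r.2.

(* The row sum attached to a pair of cells, up to sign: it only measures the
   move when the sign [s] is that of [ptA], and picks up twice the offset
   [(oa, ob)] when it is the opposite one. *)
Definition deviation (m v : nat) (oa ob : int) (s : cell -> bool) (u : cell * cell) : elt :=
  let: ((a, i), (a', i')) := u in
  if s (a, i) == positive_half v (a, i) then
    vec m (2 * v) (Posz a - Posz a')%R (2 * (Posz i - Posz i'))%R false
  else vec m (2 * v) (2 * oa + 3 * Posz a + Posz a')%R
                     (2 * (ob + 3 * Posz i + Posz i'))%R false.

(** Each sum is the deviation or its negative, and negation preserves the order. *)
Lemma gorder_rows m v oa ob s u : 0 < m -> 0 < v ->
  let o := gorder m (2 * v) (deviation m v oa ob s u) in
  [/\ gorder m (2 * v) (sum3 m (2 * v) (row1 m v oa ob s u)) = o,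
      gorder m (2 * v) (sum3 m (2 * v) (row2 m v oa ob s u)) = o &
      gorder m (2 * v) (sum3 m (2 * v) (row3 m v oa ob s u)) = o].
Proof.
move=> m0 v0; have N0 : 0 < 2 * v by lia.
case: u => [[a i] [a' i']] /=.
rewrite /deviation /row1 /row2 /row3 /sum3 /ptA /ptB /ptC /= !addbF.
case: (s _); case: (positive_half _ _); rewrite /= !gadd_vec //=;
  split; first [by congr (gorder _ _ (vec _ _ _ _ _)); ring
               |by rewrite -gorder_vecN //; congr (gorder _ _ (vec _ _ _ _ _)); ring].
Qed.

Lemma gadd_gzero m N x : x \in Gamma m N -> gadd m N gzero x = x.
Proof.
by case: x => [[a b] t]; rewrite mem_Gamma /gadd /= !add0n => /andP[h1 h2]; rewrite !modn_small.
Qed.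

Lemma perm_map_eq_in (T1 T2 : eqType) (f g : T1 -> T2) (s : seq T1) :
  {in s, f =1 g} -> perm_eq (map f s) (map g s).
Proof. by move=> /eq_in_map ->. Qed.

Lemma RSM_of_rows m N S (R : seq (elt * elt * elt)) L :
  {subset S <= Gamma m N} ->
  [/\ perm_eq [seq r.1.1 | r <- R] S, perm_eq [seq r.1.2 | r <- R] S &
      perm_eq [seq r.2 | r <- R] S] ->
  perm_eq [seq gorder m N (sum3 m N r) | r <- R] L ->
  RSM m N S 3 L.
Proof.
move=> sS [p1 p2 p3] pL.
exists [:: [seq r.1.1 | r <- R]; [seq r.1.2 | r <- R]; [seq r.2 | r <- R]]; split => //.
  by move=> c; rewrite !inE => /or3P[] /eqP->.
apply: perm_trans pL; have sz : size R = size S by rewrite -(perm_size p1) size_map.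
have -> : [seq gorder m N (sum3 m N r) | r <- R] =
    [seq gorder m N (sum3 m N (nth (gzero, gzero, gzero) R i)) | i <- iota 0 (size R)].
  by rewrite -{1}(mkseq_nth (gzero, gzero, gzero) R) -map_comp.
rewrite -sz.
apply: perm_map_eq_in => i; rewrite mem_iota /= add0n => iR.
(* [rowsum] starts from [gzero], which is neutral only for reduced entries, hence the membership in
   [Gamma]. *)
rewrite /rowsum /= !(nth_map (gzero, gzero, gzero)) // gadd_gzero //.
by apply: sS; rewrite -(perm_mem p1); apply: (map_f (fun r => r.1.1)); apply: mem_nth.
Qed.

(** * Three columns with prescribed orders *)

(** Unlike [tiling], this constrains orders instead of gaps, so it also covers a cell with reversed
    sign. *)
Definition routed_by_order m v oa ob s h l : Prop :=
  exists PH PV, [/\ routing (rect 0 0 m v) (PH ++ PV),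
    all (fun u => gorder m (2 * v) (deviation m v oa ob s u) == m) PH,
    all (fun u => gorder m (2 * v) (deviation m v oa ob s u) == v) PV,
    size PH = h & size PV = l].

Lemma RSM3_of_routings m v oa ob s h1 l1 h2 l2 h3 l3 :
  odd m -> 0 < v -> odd `|ob| ->
  routed_by_order m v oa ob s h1 l1 -> routed_by_order m v oa ob s h2 l2 ->
  routed_by_order m v oa ob s h3 l3 ->
  RSM m (2 * v) (Gamma_minus_2Gamma m (2 * v)) 3
    (nseq (h1 + h2 + h3) m ++ nseq (l1 + l2 + l3) v).
Proof.
move=> om v0 oob [H1 [V1 [r1 aH1 aV1 <- <-]]] [H2 [V2 [r2 aH2 aV2 <- <-]]]
  [H3 [V3 [r3 aH3 aV3 <- <-]]].
have m0 : 0 < m by case: (m) om.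
apply: (RSM_of_rows _ (rows_columns oa s om v0 oob r1 r2 r3)).
  by move=> x; rewrite mem_filter => /andP[].
rewrite /rows !map_cat -!map_comp.
have E k P : all (fun u => gorder m (2 * v) (deviation m v oa ob s u) == k) P ->
  [/\ map (gorder m (2 * v) \o sum3 m (2 * v) \o row1 m v oa ob s) P = nseq (size P) k,
      map (gorder m (2 * v) \o sum3 m (2 * v) \o row2 m v oa ob s) P = nseq (size P) k &
      map (gorder m (2 * v) \o sum3 m (2 * v) \o row3 m v oa ob s) P = nseq (size P) k].
  elim: P => //= u P IH /andP[/eqP e /IH[-> -> ->]].
  by have [-> -> ->] := gorder_rows oa ob s u m0 v0; rewrite e.
have [e1 _ _] := E _ _ aH1; have [e1' _ _] := E _ _ aV1.
have [_ e2 _] := E _ _ aH2; have [_ e2' _] := E _ _ aV2.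
have [_ _ e3] := E _ _ aH3; have [_ _ e3'] := E _ _ aV3.
rewrite /comp /= in e1 e1' e2 e2' e3 e3' *; rewrite e1 e1' e2 e2' e3 e3'.
by apply/permP => p; rewrite !count_cat !count_nseq; ring.
Qed.

Lemma gorder_hstep m v oa ob s u : 0 < m -> 0 < v ->
  s u.1 = positive_half v u.1 -> hstep m u ->
  gorder m (2 * v) (deviation m v oa ob s u) = m.
Proof.
case: u => [[a i] [a' i']] m0 v0 /= -> /andP[/= /eqP -> c].
rewrite eqxx; apply: gorder_horizontal; rewrite // ?muln_gt0 ?v0 //.
  by rewrite (_ : `|_| = gap a a') // /gap; lia.
by rewrite subrr mulr0 dvdz0.
Qed.

Lemma gorder_vstep m v oa ob s u : 0 < m -> 0 < v ->
  s u.1 = positive_half v u.1 -> vstep v u ->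
  gorder m (2 * v) (deviation m v oa ob s u) = v.
Proof.
case: u => [[a i] [a' i']] m0 v0 /= -> /andP[/= /eqP -> c].
rewrite eqxx; apply: gorder_vertical; rewrite // ?subrr ?dvdz0 //.
by rewrite (_ : `|_| = gap i i') // /gap; lia.
Qed.

(** [D] holds the exceptional cells, whose orders are checked directly; on [C] the signs agree and
    the tiling decides. *)
Lemma routed_of_tiling m v oa ob s D C EH EV h l : 0 < m -> 0 < v ->
  perm_eq (rect 0 0 m v) (D ++ C) -> {in C, s =1 positive_half v} ->
  routing D (EH ++ EV) ->
  all (fun u => gorder m (2 * v) (deviation m v oa ob s u) == m) EH ->
  all (fun u => gorder m (2 * v) (deviation m v oa ob s u) == v) EV ->
  tiling m v C h l -> routed_by_order m v oa ob s (size EH + h) (size EV + l).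
Proof.
move=> m0 v0 pD sC /andP[d1 d2] aEH aEV [PH [PV [/andP[c1 c2] aH aV <- <-]]].
have inC u : u \in PH ++ PV -> s u.1 = positive_half v u.1.
  by move=> hu; apply: sC; rewrite -(perm_mem c1) map_f.
exists (EH ++ PH), (EV ++ PV); split; rewrite ?size_cat ?all_cat ?aEH ?aEV //=.
- have p : perm_eq ((EH ++ PH) ++ (EV ++ PV)) ((EH ++ EV) ++ (PH ++ PV)).
    by rewrite -!catA perm_cat2l perm_catCA.
  by apply/andP; split; apply: perm_trans (perm_map _ p) _;
    rewrite map_cat perm_sym; apply: (perm_trans pD); rewrite perm_sym perm_cat.
- apply/allP => u hu; apply/eqP/gorder_hstep => //; first by rewrite inC // mem_cat hu.
  exact: (allP aH).
- apply/allP => u hu; apply/eqP/gorder_vstep => //; first by rewrite inC // mem_cat hu orbT.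
  exact: (allP aV).
Qed.

(* The sign at the cell [(0, 0)] is reversed when [f] holds. *)
Definition flipped_half (v : nat) (f : bool) (w : cell) : bool :=
  positive_half v w (+) (f && (w == (0, 0))).

(** The moves on [D] are repeated in all three classes of rows, hence the factors 3. The [h] pairs
    of horizontal moves on [C] are distributed greedily among the classes. *)
Lemma RSM3_of_flexible m v oa ob f (D C : seq cell) EH EV alpha beta h l :
  odd m -> 0 < v -> odd `|ob| ->
  perm_eq (rect 0 0 m v) (D ++ C) -> (f ==> ((0, 0) \in D)) ->
  routing D (EH ++ EV) ->
  all (fun u => gorder m (2 * v) (deviation m v oa ob (flipped_half v f) u) == m) EH ->
  all (fun u => gorder m (2 * v) (deviation m v oa ob (flipped_half v f) u) == v) EV ->
  flexible m v C -> alpha = 3 * size EH + h.*2 -> beta = 3 * size EV + l.*2 ->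
  (h + l).*2 = 3 * size C ->
  RSM m (2 * v) (Gamma_minus_2Gamma m (2 * v)) 3 (nseq alpha m ++ nseq beta v).
Proof.
move=> om v0 oob pD fD rD aEH aEV fl ea eb ehl; have m0 : 0 < m by case: (m) om.
have sC : {in C, flipped_half v f =1 positive_half v}.
  move=> w wC; rewrite /flipped_half; case: f fD {aEH aEV} => /= [D0|_]; last by rewrite addbF.
  have := rect_uniq 0 0 m v; rewrite (perm_uniq pD) cat_uniq => /and3P[_ /hasPn /(_ _ wC) /= nD _].
  by have [e|] := eqVneq w (0, 0); [rewrite e D0 in nD|rewrite addbF].
have T k : k.*2 <= size C -> _ :=
  fun lk => routed_of_tiling m0 v0 pD sC rD aEH aEV (fl k lk).
pose h1 := minn h (size C)./2; pose h2 := minn (h - h1) (size C)./2; pose h3 := h - h1 - h2.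
have L1 : h1.*2 <= size C by rewrite /h1; lia.
have L2 : h2.*2 <= size C by rewrite /h2; lia.
have L3 : h3.*2 <= size C by rewrite /h3 /h2 /h1; lia.
have R := RSM3_of_routings om v0 oob (T _ L1) (T _ L2) (T _ L3).
have eh : h1 + h2 + h3 = h by rewrite /h3 /h2 /h1; lia.
clearbody h1 h2 h3.
move: R; set x := _ + _ + _; set y := _ + _ + _.
have -> : x = alpha by rewrite /x; lia.
by have -> : y = beta by rewrite /y; lia.
Qed.

(** * Adding a column *)

(* A row [(p, q, r)] of the zero-sum matrix provides the pair [(p, q)], as [p + q = - r]. *)
Lemma split_Gamma_minus_2Gamma m v (S := Gamma_minus_2Gamma m (2 * v)) :
  odd m -> 0 < v -> exists R : seq (elt * elt),
  [/\ perm_eq (map fst R) S, perm_eq (map snd R) S &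
      perm_eq [seq gadd m (2 * v) r.1 r.2 | r <- R] S].
Proof.
move=> om v0; have m0 : 0 < m by case: (m) om.
have N0 : 0 < 2 * v by lia.
pose P := [seq (w, w) | w <- rect 0 0 m v].
have rP : routing (rect 0 0 m v) P by rewrite /routing -!map_comp !map_id perm_refl.
have [p1 p2 _] := @rows_columns m v 0%R 1%R (positive_half v) P P P om v0 isT rP rP rP.
exists [seq r.1 | r <- rows m v 0%R 1%R (positive_half v) P P P].
rewrite -!map_comp; split => //.
(* The sums are the inverses of the third letters: elements with tau = 1 are their own inverses, and
   the others become the letters with [neg] true. *)
apply: perm_trans (@perm_letters m v 0%R 1%R true om v0 isT).
rewrite /rows !map_cat -!map_comp.
have -> A B D : perm_eq (D ++ A ++ B) (letters m v 0%R 1%R true) =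
  perm_eq (A ++ B ++ D) (letters m v 0%R 1%R true) by rewrite perm_catC -catA.
rewrite (@eq_map _ _ _ (fun w =>
  if positive_half v w then ptA m v 0%R 1%R true w else ptB m v w)); last first.
  move=> w; rewrite /row2 /ptA /ptB /ptC /=; case: (positive_half v w); rewrite /= gadd_vec //=;
  congr vec; ring.
rewrite (@eq_map _ _ (_ \o (row1 _ _ _ _ _ \o _)) (fun w =>
  if positive_half v w then ptB m v w else ptA m v 0%R 1%R true w)); last first.
  move=> w; rewrite /row1 /ptA /ptB /ptC /=; case: (positive_half v w); rewrite /= gadd_vec //=;
  congr vec; ring.
rewrite (@eq_map _ _ (_ \o (row3 _ _ _ _ _ \o _)) (ptC m v 0%R 1%R)); last first.
  move=> w; rewrite /row3 /ptA /ptB /ptC /=; case: (positive_half v w); rewrite /= gadd_vec //=;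
  congr vec; ring.
exact: perm_letter_columns.
Qed.

Lemma perm_eq_map_lift (T1 : eqType) (T2 : eqType) (F : T1 -> T2) (R : seq T1)
    (c : seq T2) (x0 : T1) :
  perm_eq c (map F R) -> exists2 R', perm_eq R' R & map F R' = c.
Proof.
move=> /(perm_iotaP (F x0)) [Is pI ->].
exists [seq nth x0 R i | i <- Is].
  by apply/(perm_iotaP x0); exists Is => //; rewrite size_map in pI.
rewrite -map_comp; apply/eq_in_map => i.
rewrite (perm_mem pI) mem_iota add0n size_map => /andP[_ iR].
by rewrite /= (nth_map x0).
Qed.

Lemma RSM_succ m v g L (S := Gamma_minus_2Gamma m (2 * v)) :
  odd m -> 0 < v -> 0 < g -> RSM m (2 * v) S g L -> RSM m (2 * v) S g.+1 L.
Proof.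
move=> om v0 g0 [[|c M] [/= sz pM pL]]; first by rewrite -sz in g0.
have sS : {subset S <= Gamma m (2 * v)} by move=> x; rewrite mem_filter => /andP[].
have [R [p1 p2 p3]] := split_Gamma_minus_2Gamma om v0.
have pc : perm_eq c S by apply: pM; rewrite mem_head.
have [|R' pR eR] := @perm_eq_map_lift _ _ (fun r => gadd m (2 * v) r.1 r.2) R c (gzero, gzero).
  by apply: (perm_trans pc); rewrite perm_sym.
exists (map fst R' :: map snd R' :: M); split; first by rewrite /= sz.
  move=> d; rewrite !inE => /or3P[/eqP->|/eqP->|dM].
  - by apply: perm_trans p1; apply: perm_map.
  - by apply: perm_trans p2; apply: perm_map.
  - by apply: pM; rewrite inE dM orbT.
apply: perm_trans pL; apply: perm_map_eq_in => i.
rewrite mem_iota add0n => /andP[_ iS].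
have sR : size R' = size S by rewrite -(perm_size pc) -eR size_map.
have iR : i < size R' by rewrite sR.
have pi : (nth (gzero, gzero) R' i).1 \in S.
  by rewrite -(perm_mem p1) -(perm_mem (perm_map fst pR)); apply: map_f; apply: mem_nth.
have ci : nth gzero c i \in S by rewrite -(perm_mem pc) mem_nth // -eR size_map.
rewrite /rowsum /= (nth_map (gzero, gzero)) // (nth_map (gzero, gzero)) //.
rewrite !gadd_gzero ?sS // -eR (nth_map (gzero, gzero)) //.
Qed.

Theorem mainTheorem10 (g k m n alpha beta : nat) :
  3 <= g -> odd m -> odd n -> alpha != 1 -> beta != 1 ->
  alpha + beta = 3 * 2 ^ k * m * n ->
  RSM m (2 ^ k.+1 * n) (Gamma_minus_2Gamma m (2 ^ k.+1 * n)) g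
      (nseq alpha m ++ nseq beta (2 ^ k * n)).
Proof.
move=> g3 om on a1 b1 eab; rewrite expnS -mulnA.
have eM : alpha + beta = 3 * (m * (2 ^ k * n)) by rewrite eab; ring.
have {eab on} v0 : 0 < 2 ^ k * n by rewrite muln_gt0 expn_gt0; case: (n) on.
(* From here on [k] and [n] enter only through the positive integer [v]. *)
move: (2 ^ k * n) v0 eM => v v0 eM.
have m0 : 0 < m by case: (m) om.
elim: g g3 => // g IH; rewrite leq_eqVlt => /orP[/eqP e|lt]; last first.
  by apply: RSM_succ => //; [lia|apply: IH].
rewrite -e {IH g e}.
have c2m : coprime 2 m by rewrite coprime2n.
have s0 f : flipped_half v f (0, 0) = positive_half v (0, 0) (+) f.
  by rewrite /flipped_half andbT.
have neq (b : bool) : (b (+) true == b) = false by case: b.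
have [ov|ev] := boolP (odd v).
- have [C [pC fC]] := flexible_punctured om ov.
  have sC : (size C).+1 = m * v by rewrite -(size_rect 0 0 m v) (perm_size pC).
  have oM : odd (m * v) by rewrite oddM om.
  pose u0 : cell * cell := ((0, 0), (0, 0)).
  have [ob|eb] := boolP (odd beta).
  (* With offset o = (0, 1), the fixed cell of reversed sign gives 2o = (0, 2), of order [v], three
     times; [beta] is odd and not 1, so at least 3. *)
  + have := @RSM3_of_flexible m v 0%R 1%R true [:: (0, 0)] C [::] [:: u0] alpha beta
      alpha./2 (beta - 3)./2       om v0 isT pC isT isT isT _ fC.
    rewrite /= s0 neq gorder_vertical // ?coprime1n // eqxx => /(_ isT) H.
    by apply: H; lia.
  (* Here [alpha] is odd. The offset (1, v) is allowed as [v] is odd, and 2o = (2, 0) has order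
     [m]. *)
  + have := @RSM3_of_flexible m v 1%R (Posz v) true [:: (0, 0)] C [:: u0] [::] alpha beta
      (alpha - 3)./2 beta./2       om v0 ov pC isT isT _ isT fC.
    rewrite /= s0 neq gorder_horizontal ?muln_gt0 ?v0 //; last first.
      by rewrite mulr0 !addr0 dvdz_double.
    rewrite eqxx => /(_ isT) H.
    by apply: H; lia.
- have eM' : ~~ odd (m * v) by rewrite oddM negb_and ev orbT.
  have [ob|eb] := boolP (odd beta).
  + have [C [pC fC]] := flexible_minus_domino om ev v0.
    have sC : (size C).+2 = m * v by rewrite -(size_rect 0 0 m v) (perm_size pC).
    (* Both [alpha] and [beta] are odd. The domino is swapped: the offset (1, -1) turns the move
       from the reversed cell (0, 0) into (2, 0), of order [m], while the move back is an ordinary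
       vertical one. *)
    have := @RSM3_of_flexible m v 1%R (-1)%R true [:: (0, 0); (0, 1)] C
      [:: ((0, 0), (0, 1))] [:: ((0, 1), (0, 0))] alpha beta
      (alpha - 3)./2 (beta - 3)./2       om v0 isT pC isT isT _ _ fC.
    rewrite /= s0 neq gorder_horizontal ?muln_gt0 ?v0 //.
    rewrite /flipped_half addbF !eqxx gorder_vertical // ?coprime1n // !eqxx => /(_ isT isT) H.
    by apply: H; lia.
  (* Both multiplicities are even, so no sign is reversed. *)
  + have fC : flexible m v (rect 0 0 m v).
      by have [e|m1] := eqVneq m 1; apply: flexible_rect => //; rewrite ?e ?m1.
    have sC := size_rect 0 0 m v.
    have := @RSM3_of_flexible m v 0%R 1%R false [::] (rect 0 0 m v) [::] [::] alpha beta
      alpha./2 beta./2       om v0 isT (perm_refl _) isT isT isT isT fC.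
    rewrite sC /= => H; by apply: H; lia.
Qed.
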